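(* For every $\epsilon>0$ and every $n\ge 1$ there exists an instance of the two-block problem with $n$ coupled binary variables for which SDA with $\lambda=0$ requires $\Omega(2^n)$ iterations to achieve $\epsilon$-optimality (i.e. to reach $\mathrm{UB}-\mathrm{LB}\le\epsilon$), while the V-Lagrangian dual problem $\max_{\lambda,\mu}L^V(\lambda,\mu)$ can be solved to $\epsilon$-optimality (additive error) by the classic sub-gradient method in $O(n^2(n+2))$ iterations. The constants in $\Omega(\cdot)$ and $O(\cdot)$ are absolute.
   Context: Two-block problem. For $i\in\{1,2\}$ let $$\mathcal{X}^{(i)}=\{(x^{(i)},y^{(i)}): A^{(i)}x^{(i)}+B^{(i)}y^{(i)}\le b^{(i)},\ y^{(i)}\ge 0 \text{ mixed-integer},\ x^{(i)}\in\{0,1\}^n\}$$ (the $y^{(i)}$ variables may be absent). The problem is $$\min\Big\{\sum_{i\in\{1,2\}}\langle c^{(i)},x^{(i)}\rangle+\langle d^{(i)},y^{(i)}\rangle:\ (x^{(i)},y^{(i)})\in\mathcal{X}^{(i)},\ i\in\{1,2\},\ x^{(1)}=x^{(2)}\Big\}.$$ V-Lagrangian dual. For $v\in\{0,1\}^n$ put $\sigma_{v_j}(u)=u$ if $v_j=1$ and $\sigma_{v_j}(u)=1-u$ if $v_j=0$. Let $$\mathcal{X}^{(i)}_V=\Big\{(x^{(i)},y^{(i)},w^{(i)}):(x^{(i)},y^{(i)})\in\mathcal{X}^{(i)},\ w^{(i)}_v=\prod_{s\in[n]}\sigma_{v_s}(x^{(i)}_s)\ \ \forall v\in\{0,1\}^n\Big\},$$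 and for $\lambda\in\mathbb{R}^n$, $\mu\in\mathbb{R}^{\{0,1\}^n}$ let $L^V(\lambda,\mu)$ be the minimum of $\sum_{i}(\langle c^{(i)},x^{(i)}\rangle+\langle d^{(i)},y^{(i)}\rangle)+\langle\lambda,x^{(1)}-x^{(2)}\rangle+\langle\mu,w^{(1)}-w^{(2)}\rangle$ over $(x^{(i)},y^{(i)},w^{(i)})\in\mathcal{X}^{(i)}_V$, $i\in\{1,2\}$. $L^V$ is concave. Classic sub-gradient method: starting from $z_1=(\lambda_1,\mu_1)=0$, each iteration computes some supergradient $g_r$ of $L^V$ at $z_r$ and sets $z_{r+1}=z_r+\alpha_r g_r$ for a chosen step size $\alpha_r>0$. It solves the dual to $\epsilon$-optimality within $N$ iterations if some iterate $z_r$ among those produced satisfies $L^V(z_r)\ge\max L^V-\epsilon$. SDA (scenario decomposition algorithm) with $\lambda=0$: initialize $\mathrm{UB}=\infty$, $\mathrm{LB}=-\infty$, $\mathcal{V}=\emptyset$. While $\mathrm{UB}>\mathrm{LB}$, perform an iteration: (1) for $i\in\{1,2\}$ let $(x_*^{(i)},y_*^{(i)})$ be a minimizer, with value $p_i$, of $\langle c^{(i)},x^{(i)}\rangle+\langle d^{(i)},y^{(i)}\rangle$ over $(x^{(i)},y^{(i)})\in\mathcal{X}^{(i)}$ with $x^{(i)}\notin\mathcal{V}$; if one of these sub-problems is infeasible, the algorithm terminates; (2) set $\mathrm{LB}\leftarrow\max\{\mathrm{LB},p_1+p_2\}$; (3) let $h_1=\min\{\langle c^{(1)}+c^{(2)},x_*^{(1)}\rangle+\langle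 d^{(1)},y_*^{(1)}\rangle+\langle d^{(2)},y^{(2)}\rangle:(x_*^{(1)},y^{(2)})\in\mathcal{X}^{(2)}\}$ and $h_2=\min\{\langle c^{(1)}+c^{(2)},x_*^{(2)}\rangle+\langle d^{(1)},y^{(1)}\rangle+\langle d^{(2)},y_*^{(2)}\rangle:(x_*^{(2)},y^{(1)})\in\mathcal{X}^{(1)}\}$ ($+\infty$ if infeasible), and set $\mathrm{UB}\leftarrow\min\{\mathrm{UB},h_1,h_2\}$; (4) set $\mathcal{V}\leftarrow\mathcal{V}\cup\{x_*^{(1)},x_*^{(2)}\}$. *)

(* Defs.v *)
From mathcomp Require Import all_boot all_order all_algebra.
From mathcomp Require Import boolp classical_sets reals constructive_ereal ereal.

Set Implicit Arguments.
Unset Strict Implicit.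
Unset Printing Implicit Defensive.

Import Order.TTheory GRing.Theory Num.Theory.
Local Open Scope classical_set_scope.
Local Open Scope ring_scope.

(* {0,1}^n: coupled binary vectors, and also the index set of the products. *)
Definition cube (n : nat) : finType := {ffun 'I_n -> bool}.

Definition dot (R : realType) (n : nat) (u v : 'cV[R]_n) : R :=
  \sum_(j < n) u j 0 * v j 0.

Definition bvec (R : realType) (n : nat) (x : cube n) : 'cV[R]_n :=
  \col_j (x j)%:R.

Definition argmin (R : realType) (T : Type) (f : T -> R) (S : set T) (t : T)
    : Prop :=
  S t /\ forall t', S t' -> f t <= f t'.

(* The y-variables with index in [bintg] are integral, the others continuous;
   [bydim = 0] is the case without y-variables. *)
Record block (R : realType) (n : nat) := Block {
  brows : nat;
  bydim : nat;
  bA : 'M[R]_(brows, n);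
  bB : 'M[R]_(brows, bydim);
  bb : 'cV[R]_brows;
  bintg : {set 'I_bydim};
  bc : 'cV[R]_n;
  bd : 'cV[R]_bydim }.

Record two_block (R : realType) (n : nat) := TwoBlock {
  blk1 : block R n;
  blk2 : block R n }.

Section Problem.
Context {R : realType} {n : nat}.
Implicit Types (B : block R n) (P : two_block R n).

Definition bpoint B : Type := (cube n * 'cV[R]_(bydim B))%type.

Definition bfeas B : set (bpoint B) :=
  [set t | [/\ forall i, (bA B *m bvec R t.1 + bB B *m t.2) i 0 <= bb B i 0,
               forall j, 0 <= t.2 j 0
             & forall j, j \in bintg B -> t.2 j 0 \is a Num.int]].

Definition bobj B (t : bpoint B) : R :=
  dot (bc B) (bvec R t.1) + dot (bd B) t.2.

Definition tb_feas P : set (bpoint (blk1 P) * bpoint (blk2 P)) :=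
  [set t | [/\ bfeas t.1, bfeas t.2 & t.1.1 = t.2.1]].

Definition tb_obj P (t : bpoint (blk1 P) * bpoint (blk2 P)) : R :=
  bobj t.1 + bobj t.2.

Definition fibres_attained B : Prop :=
  forall x y, bfeas (B := B) (x, y) ->
    exists y', argmin (dot (bd B)) [set y0 | bfeas (B := B) (x, y0)] y'.

(* The problem has an optimal solution, and so has each block once its binary
   part is fixed to a feasible value.  As the cube is finite, it follows that
   every infimum taken below over a nonempty set is an attained minimum. *)
Definition well_posed P : Prop :=
  [/\ exists t, argmin (tb_obj (P := P)) (tb_feas (P := P)) t,
      fibres_attained (blk1 P) & fibres_attained (blk2 P)].

(* The V-Lagrangian dual *)

(* A dual vector (lambda, mu) in R^n x R^({0,1}^n); R^o is R seen as a module
   over itself, so that dual vectors can be added and scaled. *)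
Definition dualvec : Type := ('cV[R]_n * {ffun cube n -> R^o})%type.

Definition vdot (mu w : {ffun cube n -> R^o}) : R := \sum_v mu v * w v.

Definition dualdot (z g : dualvec) : R := dot z.1 g.1 + vdot z.2 g.2.

Definition sigma (b : bool) (u : R) : R := if b then u else 1 - u.

Definition bpointV B : Type := (bpoint B * {ffun cube n -> R^o})%type.

Definition bfeasV B : set (bpointV B) :=
  [set t : bpointV B | bfeas t.1 /\
     forall v : cube n, t.2 v = \prod_(s < n) sigma (v s) (bvec R t.1.1 s 0)].

Definition lagrangian P (z : dualvec)
    (t : bpointV (blk1 P) * bpointV (blk2 P)) : R :=
  bobj t.1.1 + bobj t.2.1
  + dot z.1 (bvec R t.1.1.1 - bvec R t.2.1.1)
  + vdot z.2 (t.1.2 - t.2.2).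

Definition LV P (z : dualvec) : R :=
  inf [set lagrangian z t |
        t in [set t | bfeasV (B := blk1 P) t.1 /\ bfeasV (B := blk2 P) t.2]].

Definition supergradient P (z g : dualvec) : Prop :=
  forall z', LV P z' <= LV P z + dualdot g (z' - z).

(* Iterates are indexed from 0: [z r] is the point reached after r updates. *)
Definition subgradient_run P (alpha : nat -> R) (z : nat -> dualvec) : Prop :=
  z 0 = 0 /\
  forall r, exists2 g, supergradient P (z r) g & z r.+1 = z r + alpha r *: g.

(* The step sizes are fixed in advance; every choice of supergradients has to
   succeed within the first N iterations. *)
Definition subgradient_solves P (eps : R) (N : nat) : Prop :=
  exists zmax, (forall z, LV P z <= LV P zmax) /\
  exists alpha : nat -> R, (forall r, 0 < alpha r) /\
    forall z, subgradient_run P alpha z ->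
      exists r, (r <= N)%N /\ LV P zmax - eps <= LV P (z r).

(* The scenario decomposition algorithm with lambda = 0 *)

Record sda_state := SDAState {
  sda_ub : \bar R;
  sda_lb : \bar R;
  sda_cuts : {set cube n} }.

Definition sda_init : sda_state := SDAState +oo%E -oo%E finset.set0.

Definition sda_sub B (V : {set cube n}) : set (bpoint B) :=
  [set t | bfeas t /\ t.1 \notin V].

(* The best completion of the block solution [t] by y-variables of the other
   block [B']; the infimum of the empty set is +oo. *)
Definition sda_h B B' (t : bpoint B) : \bar R :=
  ereal_inf
    [set (dot (bc B + bc B') (bvec R t.1) + dot (bd B) t.2 + dot (bd B') y)%:E |
      y in [set y | bfeas (B := B') (t.1, y)]].

Definition sda_step P (s s' : sda_state) : Prop :=
  (sda_lb s < sda_ub s)%E /\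
  exists (t1 : bpoint (blk1 P)) (t2 : bpoint (blk2 P)),
    [/\ argmin (bobj (B := blk1 P)) (sda_sub (B := blk1 P) (sda_cuts s)) t1,
        argmin (bobj (B := blk2 P)) (sda_sub (B := blk2 P) (sda_cuts s)) t2
      & s' = SDAState
          (Order.min (sda_ub s)
             (Order.min (sda_h (blk2 P) t1) (sda_h (blk1 P) t2)))
          (Order.max (sda_lb s) (bobj t1 + bobj t2)%:E)
          (t1.1 |: (t2.1 |: sda_cuts s))%SET].

(* [sda_reach P k s]: some execution is in state s after k full iterations. *)
Inductive sda_reach P : nat -> sda_state -> Prop :=
| sda_reach0 : sda_reach P 0 sda_init
| sda_reachS k s s' :
    sda_reach P k s -> sda_step P s s' -> sda_reach P k.+1 s'.

Definition sda_infeasible P (s : sda_state) : Prop :=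
  sda_sub (B := blk1 P) (sda_cuts s) = classical_sets.set0 \/
  sda_sub (B := blk2 P) (sda_cuts s) = classical_sets.set0.

(* Along every execution, whatever minimizers are picked, the gap exceeds eps
   during the first (less than K) iterations.  Running out of feasible points
   also ends the algorithm, so an early stop of that kind is excluded too. *)
Definition sda_requires P (eps K : R) : Prop :=
  forall k s, sda_reach P k s ->
    (sda_ub s - sda_lb s <= eps%:E)%E \/ sda_infeasible P s -> K <= k%:R.

End Problem.

(* Main.v *)
Require Import Defs.
From mathcomp Require Import all_boot all_order all_algebra.
From mathcomp Require Import boolp classical_sets reals constructive_ereal ereal.
From mathcomp Require Import ring lra zify.

Set Implicit Arguments.
Unset Strict Implicit.
Unset Printing Implicit Defensive.

Import Order.TTheory GRing.Theory Num.Theory.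
Local Open Scope ring_scope.

(** Both blocks are the whole cube, without y-variables, and have the opposite
    costs M * sum_j x_j and - M * sum_j x_j with M = 2 eps, so that every
    coupled solution costs 0.

    After k iterations SDA has cut at most 2k points.  As long as 4k < 2^n, some
    x and the point obtained from it by flipping one fixed coordinate both
    survive; their weights differ by 1, so the lower bound of the next iteration
    is at most - M, while the upper bound stays nonnegative.

    The dual function is the minimum of <z - z*, h> over the differences
    h = (x1 - x2, w1 - w2), where z* = (- M, ..., - M; 0) is a maximizer of value
    0.  Since |h|^2 <= n + 2, all supergradients satisfy |g|^2 <= n + 2, and the
    constant step eps / (n + 2) decreases |z - z*|^2 by at least
    eps^2 / (n + 2) whenever z is not eps-optimal.  As |z*|^2 = 4 n eps^2, this
    happens at most 4 n (n + 2) times. *)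

(** * The Euclidean pairing on dual vectors *)

Section DualVectors.
Context {R : realType} {n : nat}.
Implicit Types a b g h z : @dualvec R n.

Lemma dualdotC a b : dualdot a b = dualdot b a.
Proof.
by congr (_ + _); apply: eq_bigr => i _; rewrite mulrC.
Qed.

Lemma dualdotDl a b h : dualdot (a + b) h = dualdot a h + dualdot b h.
Proof.
rewrite /dualdot /dot /vdot addrACA -!big_split /=.
by congr (_ + _); apply: eq_bigr => i _; rewrite ?mxE ?ffunE mulrDl.
Qed.

Lemma dualdotZl (k : R) a h : dualdot (k *: a) h = k * dualdot a h.
Proof.
rewrite /dualdot /dot /vdot mulrDr !mulr_sumr /=.
by congr (_ + _); apply: eq_bigr => i _; rewrite ?mxE ?ffunE mulrA.
Qed.

Lemma dualdotBl a b h : dualdot (a - b) h = dualdot a h - dualdot b h.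
Proof. by rewrite -scaleN1r dualdotDl dualdotZl mulN1r. Qed.

Lemma dualdotDr a b h : dualdot h (a + b) = dualdot h a + dualdot h b.
Proof. by rewrite dualdotC dualdotDl !(dualdotC h). Qed.

Lemma dualdotZr (k : R) a h : dualdot h (k *: a) = k * dualdot h a.
Proof. by rewrite dualdotC dualdotZl dualdotC. Qed.

Lemma dualdotBr a b h : dualdot h (a - b) = dualdot h a - dualdot h b.
Proof. by rewrite dualdotC dualdotBl !(dualdotC h). Qed.

Lemma dualdot_ge0 a : 0 <= dualdot a a.
Proof. by apply: addr_ge0; apply: sumr_ge0 => i _; rewrite -expr2 sqr_ge0. Qed.

Lemma dualdot_amgm a b : 2 * dualdot a b <= dualdot a a + dualdot b b.
Proof.
have := dualdot_ge0 (a - b).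
by rewrite dualdotBl !dualdotBr (dualdotC b a); lra.
Qed.

End DualVectors.

(** * The instance with opposite costs *)

Section Instance.
Context {R : realType} {n : nat}.

Definition cube_block (M : R) : block R n :=
  @Block R n 0 0 0 0 0 finset.set0 (const_mx M) 0.

Definition opposite_blocks (M : R) : two_block R n :=
  TwoBlock (cube_block M) (cube_block (- M)).

Definition weight (x : cube n) : R := \sum_j (x j)%:R.

Lemma dot_dim0 (u v : 'cV[R]_0) : dot u v = 0.
Proof. by rewrite /dot big_ord0. Qed.

Lemma cube_block_feas M (t : bpoint (cube_block M)) : bfeas t.
Proof. by split=> [[]|[]|[]]. Qed.

Lemma dot_const M (u : 'cV[R]_n) : dot (const_mx M) u = M * \sum_j u j 0.
Proof. by rewrite /dot mulr_sumr; apply: eq_bigr => j _; rewrite mxE. Qed.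

Lemma cube_block_obj M (t : bpoint (cube_block M)) : bobj t = M * weight t.1.
Proof.
rewrite /bobj dot_dim0 addr0 dot_const.
by congr (_ * _); apply: eq_bigr => j _; rewrite mxE.
Qed.

Lemma opposite_blocks_well_posed M : well_posed (opposite_blocks M).
Proof.
have fibres K : fibres_attained (cube_block K).
  move=> x y _; exists y; split=> [|y' _]; first exact: cube_block_feas.
  by rewrite !dot_dim0.
split; [|exact: fibres|exact: fibres].
exists (([ffun=> false], 0), ([ffun=> false], 0)).
split=> [|[t1 t2] [_ _ /= eqx]]; first by split=> //; exact: cube_block_feas.
by rewrite /tb_obj /= !cube_block_obj /= -eqx !mulNr !subrr.
Qed.

(** * Slow progress of the scenario decomposition algorithm *)

Section Sda.
Variable M : R.
Notation P := (opposite_blocks M).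

Definition flip (i : 'I_n) (x : cube n) : cube n :=
  [ffun j => if j == i then ~~ x j else x j].

Lemma flipK i : involutive (flip i).
Proof.
by move=> x; apply/ffunP => j; rewrite !ffunE; case: eqP => // _; rewrite negbK.
Qed.

Lemma weight_flip i x :
  weight (flip i x) = weight x + 1 \/ weight (flip i x) = weight x - 1.
Proof.
rewrite /weight (bigD1 i) //= [X in _ = X + 1 \/ _](bigD1 i) //=.
rewrite [X in _ \/ _ = X - 1](bigD1 i) //= ffunE eqxx.
rewrite [X in _ + X](eq_bigr (fun j => (x j)%:R)); last first.
  by move=> j ji; rewrite ffunE (negbTE ji).
by case: (x i); rewrite /= ?add0r; [right|left]; lra.
Qed.

(** [V] and its image under the flip have at most [2 * #|V|] elements together, so they miss a point
    of the cube. *)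
Lemma notin_with_flip (i : 'I_n) (V : {set cube n}) :
  (2 * #|V| < 2 ^ n)%N -> exists x, (x \notin V) && (flip i x \notin V).
Proof.
move=> ltV.
have [x] : exists x, x \notin (V :|: flip i @: V)%SET.
  apply/existsP; rewrite -negb_forall; apply/negP => /forallP allV.
  have : (#|cube n| <= #|(V :|: flip i @: V)%SET|)%N.
    by apply: subset_leq_card; apply/fintype.subsetP => x _; exact: allV.
  rewrite card_ffun card_bool card_ord; apply/negP; rewrite -ltnNge.
  apply: leq_ltn_trans (leq_card_setU _ _) _.
  by apply: leq_ltn_trans ltV; rewrite mul2n -addnn leq_add2l leq_imset_card.
rewrite inE negb_or => /andP[xV fV]; exists x; rewrite xV /=.
by apply: contra fV => fxV; apply/imsetP; exists (flip i x); rewrite ?flipK.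
Qed.

Lemma cube_block_argmin K V (t : bpoint (cube_block K)) x :
  argmin (bobj (B := cube_block K)) (sda_sub (B := cube_block K) V) t ->
  x \notin V -> bobj t <= K * weight x.
Proof.
move=> [_ tmin] xV; rewrite -[X in _ <= X](@cube_block_obj K (x, 0)).
by apply: tmin; split=> //; exact: cube_block_feas.
Qed.

(** The costs of the two blocks cancel on a common [x], so every completion costs exactly 0. *)
Lemma sda_h_ge0 K (t : bpoint (cube_block K)) :
  (0 <= sda_h (cube_block (- K)) t)%E.
Proof.
apply: le_ereal_inf_tmp => _ [y _ <-]; rewrite lee_fin !dot_dim0 !addr0 /=.
rewrite (_ : _ + _ = const_mx 0) ?dot_const ?mul0r //.
by apply/matrixP => ? ?; rewrite !mxE subrr.
Qed.

Lemma sda_invariant k s : (0 < n)%N -> 0 <= M -> sda_reach P k s ->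
  [/\ (#|sda_cuts s| <= 2 * k)%N, (0 <= sda_ub s)%E
    & (4 * k < 2 ^ n)%N -> (sda_lb s <= (- M)%:E)%E].
Proof.
move=> n_gt0 M_ge0; elim=> [|{}k {}s s' _ [leV ub_ge0 lb_le] []].
  by split; rewrite ?cards0 //= ?leey ?leNye.
move=> _ [t1 [t2 [min1 min2 ->]]]; split=> /=.
- rewrite mulnS; apply: leq_trans (leq_card_setU _ _) _.
  rewrite cards1 add1n ltnS; apply: leq_trans (leq_card_setU _ _) _.
  by rewrite cards1 add1n ltnS.
- rewrite !le_min ub_ge0 sda_h_ge0 /=.
  by have := @sda_h_ge0 (- M) t2; rewrite opprK.
- move=> lt4k; rewrite ge_max lb_le ?lee_fin /=; last by lia.
  have [|x /andP[xV fV]] := @notin_with_flip (Ordinal n_gt0) (sda_cuts s).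
    by lia.
  (* Block 1 is compared with the lighter of [x] and its flip, block 2 with the heavier: the two
     bounds add up to [- M]. *)
  have := cube_block_argmin min1 xV; have := cube_block_argmin min1 fV.
  have := cube_block_argmin min2 xV; have := cube_block_argmin min2 fV.
  by case: (weight_flip (Ordinal n_gt0) x) => ->; lra.
Qed.

Lemma opposite_blocks_sda_requires (eps : R) :
  (0 < n)%N -> 0 < eps -> eps < M -> sda_requires P eps (4^-1 * 2 ^+ n).
Proof.
move=> n_gt0 eps_gt0 ltM k s reach stop; rewrite leNgt; apply/negP => klt.
have lt4k : (4 * k < 2 ^ n)%N.
  by rewrite -(ltr_nat R) natrM natrX; lra.
have M_ge0 : 0 <= M by lra.
have [leV ub_ge0 /(_ lt4k) lb_le] := sda_invariant n_gt0 M_ge0 reach.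
case: stop => [gap|].
  have : (M%:E <= eps%:E)%E.
    apply: le_trans gap; rewrite -[M%:E]add0e; apply: leeD => //.
    by rewrite leeNr -EFinN.
  by rewrite lee_fin leNgt ltM.
(* Fewer than half of the points are cut, so a survivor remains feasible for either block. *)
have [|x /andP[xV _]] := @notin_with_flip (Ordinal n_gt0) (sda_cuts s).
  by lia.
by case=> E; have : set0 (x, 0 : 'cV[R]_0) by
  rewrite -E; split=> //; exact: cube_block_feas.
Qed.

End Sda.

(** * The dual function and its supergradients *)

Section Dual.
Variable M : R.
Notation P := (opposite_blocks M).
Implicit Types (z g : @dualvec R n).
Implicit Types t : bpointV (blk1 P) * bpointV (blk2 P).

(** The multiplier [- M] cancels the costs of both blocks, so the Lagrangian vanishes there at every
    feasible point. *)
Definition dual_opt : @dualvec R n := (const_mx (- M), 0).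

Definition coupling_gap t : @dualvec R n :=
  (bvec R t.1.1.1 - bvec R t.2.1.1, t.1.2 - t.2.2).

Definition feasV t : Prop := bfeasV t.1 /\ bfeasV t.2.

Lemma lagrangianE z t : lagrangian z t = dualdot (z - dual_opt) (coupling_gap t).
Proof.
rewrite dualdotBl /lagrangian !cube_block_obj -addrA addrC; congr (_ + _).
rewrite /dualdot /= dot_const [vdot _ _]big1 ?addr0; last first.
  by move=> v _; rewrite ffunE mul0r.
rewrite !mulNr opprK -mulrBr -sumrB.
by congr (_ * _); apply: eq_bigr => j _; rewrite !mxE.
Qed.

Lemma prod_sigma (x v : cube n) :
  \prod_(s < n) sigma (v s) (bvec R x s 0) = (x == v)%:R.
Proof.
case: eqP => [->|/eqP neq].
  by apply: big1 => s _; rewrite /sigma mxE; case: (v s); rewrite ?subr0.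
have [s xvs] : exists s, x s != v s.
  apply/existsP; rewrite -negb_forall; apply: contra neq => /forallP eqxv.
  by apply/eqP/ffunP => s; apply/eqP.
rewrite (bigD1 s) //= /sigma mxE.
by move: xvs; case: (x s); case: (v s); rewrite ?subrr ?mul0r.
Qed.

(** The entries of x1 - x2 lie in {-1, 0, 1} and contribute at most n. By [prod_sigma], w1 and w2
    are unit vectors, whose difference contributes at most 2. *)
Lemma coupling_gap_bound t : feasV t ->
  dualdot (coupling_gap t) (coupling_gap t) <= (n + 2)%:R.
Proof.
move=> [[_ w1] [_ w2]]; rewrite natrD; apply: lerD.
  apply: (@le_trans _ _ (\sum_(j < n) 1)); last by rewrite sumr_const card_ord.
  apply: ler_sum => j _; rewrite !mxE.
  by case: (_ j); case: (_ j); rewrite /=; lra.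
have ind (x : cube n) : \sum_v (x == v)%:R = 1 :> R.
  rewrite (bigD1 x) //= eqxx big1 ?addr0 // => v.
  by rewrite eq_sym => /negbTE ->.
have -> : 2%:R = \sum_v (t.1.1.1 == v)%:R + \sum_v (t.2.1.1 == v)%:R :> R.
  by rewrite !ind.
rewrite -big_split /=.
apply: ler_sum => v _; rewrite !ffunE w1 w2 !prod_sigma.
by case: (_ == v); case: (_ == v); rewrite /=; lra.
Qed.

(** Makes the set under the [inf] nonempty and bounds the dual function above by 0. *)
Lemma feasV_diag : exists2 t, feasV t & coupling_gap t = 0.
Proof.
pose x : cube n := [ffun=> false].
pose w : {ffun cube n -> R^o} :=
  [ffun v : cube n => \prod_(s < n) sigma (v s) (bvec R x s 0)].
exists (((x, 0), w), ((x, 0), w)); last by rewrite /coupling_gap !subrr.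
by split; split=> [|v]; rewrite ?ffunE //; exact: cube_block_feas.
Qed.

Lemma LV_ge z m :
  (forall t, feasV t -> m <= lagrangian z t) -> m <= LV P z.
Proof.
move=> mle; apply: lb_le_inf => [|_ [t ft <-]]; last exact: mle.
by have [t ft _] := feasV_diag; exists (lagrangian z t); exists t.
Qed.

Lemma LV_le z t : feasV t -> LV P z <= lagrangian z t.
Proof.
move=> ft; apply: ge_inf; last by exists t.
(* [inf] bounds its elements only if the set is bounded below; AM-GM and the bound on the gap
   provide this. *)
pose a := dual_opt - z.
exists (- ((dualdot a a + (n + 2)%:R) / 2)) => _ [u fu <-].
have := dualdot_amgm a (coupling_gap u); have := coupling_gap_bound fu.
by rewrite lagrangianE -[z - dual_opt]opprB -scaleN1r dualdotZl -/a; lra.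
Qed.

Lemma LV_le0 z : LV P z <= 0.
Proof.
have [t ft gap0] := feasV_diag; apply: le_trans (LV_le z ft) _.
by rewrite lagrangianE gap0 -(scale0r 0) dualdotZr mul0r.
Qed.

Lemma LV_opt : LV P dual_opt = 0.
Proof.
apply/eqP; rewrite eq_le LV_le0 LV_ge // => t _.
by rewrite lagrangianE subrr -(scale0r 0) dualdotZl mul0r.
Qed.

(* Testing the supergradient at [z - g] gives [|g|^2 <= L z - L (z - g)], and the
   right-hand side is at most [(|g|^2 + n + 2) / 2] by AM-GM. *)
Lemma supergradient_bound z g :
  supergradient P z g -> dualdot g g <= (n + 2)%:R.
Proof.
move=> /(_ (z - g)); rewrite addrAC subrr add0r -scaleN1r dualdotZr => sup.
have : LV P z - (dualdot g g + (n + 2)%:R) / 2 <= LV P (z + -1 *: g).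
  apply: LV_ge => t ft; have := LV_le z ft; have := coupling_gap_bound ft.
  have := dualdot_amgm g (coupling_gap t).
  by rewrite !lagrangianE !dualdotBl dualdotDl dualdotZl; lra.
lra.
Qed.

(** Put a = z - z* and s = eps / (n + 2). The supergradient inequality at z* gives <g, a> <= L z < -
    eps, and s |g|^2 <= eps, so 2 s <g, a> + s^2 |g|^2 <= - s eps. *)
Lemma subgradient_descent (eps : R) z g :
  0 < eps -> supergradient P z g -> LV P z < - eps ->
  let z' := z + (eps / (n + 2)%:R) *: g in
  dualdot (z' - dual_opt) (z' - dual_opt) <=
    dualdot (z - dual_opt) (z - dual_opt) - eps ^+ 2 / (n + 2)%:R.
Proof.
move=> eps_gt0 sup ltL /=.
have G_gt0 : 0 < (n + 2)%:R :> R by rewrite ltr0n addn2.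
have gg := supergradient_bound sup.
have := sup dual_opt; rewrite LV_opt -[dual_opt - z]opprB.
rewrite -scaleN1r dualdotZr [z + _ - _]addrAC.
move: (z - dual_opt) => a ga.
rewrite !(dualdotDl, dualdotDr, dualdotZl, dualdotZr) (dualdotC a g).
set G := (n + 2)%:R in G_gt0 gg *; set s := eps / G.
have s_gt0 : 0 < s by rewrite divr_gt0.
have -> : eps ^+ 2 / G = s * eps by rewrite /s expr2 mulrAC.
have sG : s * G = eps by rewrite /s divfK // gt_eqF.
have : s * dualdot g a <= s * - eps by rewrite ler_pM2l //; lra.
have : s * (s * dualdot g g) <= s * eps by rewrite ler_pM2l // -sG ler_pM2l.
lra.
Qed.

End Dual.

(** * Convergence of the subgradient method *)

Lemma opposite_blocks_subgradient_solves (eps : R) : 0 < eps ->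
  subgradient_solves (opposite_blocks (2 * eps)) eps (4 * (n * (n + 2))).
Proof.
move=> eps_gt0; set P := opposite_blocks _; set N := (4 * _)%N.
set zs := dual_opt (2 * eps).
have G_gt0 : 0 < (n + 2)%:R :> R by rewrite ltr0n addn2.
exists zs; rewrite LV_opt; split=> [z|]; first exact: LV_le0.
exists (fun=> eps / (n + 2)%:R); split=> [r|z [z0 zS]]; first exact: divr_gt0.
apply: contrapT => none.
have ltL r : (r <= N)%N -> LV P (z r) < - eps.
  move=> rN; rewrite ltNge; apply/negP => le; apply: none; exists r.
  by rewrite sub0r.
pose q r := dualdot (z r - zs) (z r - zs).
(* The range includes [N.+1], since the iterates 0 to [N] all fail and each yields a decrease. *)
have decr r : (r <= N.+1)%N ->
    q r <= n%:R * (2 * eps) ^+ 2 - r%:R * (eps ^+ 2 / (n + 2)%:R).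
  elim: r => [_|r IH rN].
    rewrite mul0r subr0 /q z0 sub0r -scaleN1r dualdotZl dualdotZr mulrA mulrNN.
    rewrite !mul1r /dualdot /= dot_const [vdot _ _]big1 ?addr0; last first.
      by move=> v _; rewrite ffunE mul0r.
    under eq_bigr do rewrite mxE.
    by rewrite sumr_const card_ord -mulr_natl; lra.
  have [g sup zE] := zS r; have := subgradient_descent eps_gt0 sup (ltL r rN).
  have := IH (ltnW rN).
  by rewrite /= -zE -/(q r.+1) -/(q r) -[r.+1%:R]natr1; lra.
have := decr N.+1 (leqnn _); have := dualdot_ge0 (z N.+1 - zs); rewrite -/(q _).
have e2 : 0 < eps ^+ 2 / (n + 2)%:R by rewrite divr_gt0 // exprn_gt0.
(* The initial squared distance is exactly [N] decrements, so decrement [N.+1] would make it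
   negative. *)
have -> : n%:R * (2 * eps) ^+ 2 = N%:R * (eps ^+ 2 / (n + 2)%:R).
  by rewrite /N !natrM; field; rewrite -natrD gt_eqF.
by rewrite -[N.+1%:R]natr1; lra.
Qed.

End Instance.

Theorem proposition7 (R : realType) :
  exists c C : R, 0 < c /\ 0 < C /\
    forall (eps : R) (n : nat), 0 < eps -> (1 <= n)%N ->
      exists P : two_block R n,
        [/\ well_posed P,
            sda_requires P eps (c * 2 ^+ n)
          & exists N : nat, N%:R <= C * (n ^ 2 * (n + 2))%N%:R /\
              subgradient_solves P eps N].
Proof.
(* [4^-1]: two cuts per iteration, and fewer than half of the cube may be cut. [4]: the square of M
   / eps = 2. *)
exists 4^-1, 4; do 2 (split; first by lra).
move=> eps n eps_gt0 n_gt0; exists (opposite_blocks (2 * eps)); split.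
- exact: opposite_blocks_well_posed.
- by apply: opposite_blocks_sda_requires => //; lra.
- exists (4 * (n * (n + 2)))%N; split; last first.
    exact: opposite_blocks_subgradient_solves.
  (* As n >= 1, the count 4 n (n + 2) is within the claimed bound. *)
  by rewrite -natrM ler_nat leq_mul2l leq_mul2r -mulnn leq_pmulr ?orbT.
Qed.
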